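(* There is a rational ultrametric space $(M,d)$ of cardinality $\aleph_1$ such that for every coloring $\chi:M\to\omega$ of $M$ by countably many colors and every finite rational ultrametric space $X$, there is a subset of $M$ which is monochromatic under $\chi$ and isometric to $X$.
   Context: A metric space $(X,\rho)$ is rational if $\rho(x,y)\in\mathbb Q$ for all $x,y\in X$; it is ultrametric if $\rho(x,z)\leq\max\{\rho(x,y),\rho(y,z)\}$ for all $x,y,z\in X$. *)

(* Defs.v *)
From mathcomp Require Import all_boot all_order all_algebra.
From mathcomp Require Import all_classical all_reals all_analysis.

Set Implicit Arguments.
Unset Strict Implicit.
Unset Printing Implicit Defensive.

Import Order.TTheory GRing.Theory Num.Theory.
Local Open Scope classical_set_scope.
Local Open Scope ring_scope.

Definition rational_metric (R : realType) (X : metricType R) : Prop :=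
  forall x y : X, rational (mdist x y).

Definition ultrametric (R : realType) (X : metricType R) : Prop :=
  forall x y z : X, mdist x z <= Num.max (mdist x y) (mdist y z).

(* aleph_1 is the least uncountable cardinal; the library compares cardinals
   of sets relationally and has no type of cardinals *)
Definition has_card_aleph1 (T : Type) (A : set T) : Prop :=
  ~ countable A /\
  forall (U : Type) (B : set U), ~ countable B -> (A #<= B)%card.

Definition monochromatic (T C : Type) (chi : T -> C) (A : set T) : Prop :=
  exists c : C, forall x : T, A x -> chi x = c.

Definition isometric_to_subset (R : realType) (X M : metricType R)
    (A : set M) : Prop :=
  exists f : X -> M,
    set_bij [set: X] A f /\ forall x y : X, mdist (f x) (f y) = mdist x y.

(* Main.v *)
Require Import Defs.
From HB Require Import structures.
From mathcomp Require Import finmap wochoice.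
From mathcomp Require Import all_boot all_order all_algebra.
From mathcomp Require Import all_classical all_reals all_analysis.
Local Open Scope classical_set_scope.

Set Implicit Arguments.
Unset Strict Implicit.
Unset Printing Implicit Defensive.

Import Order.TTheory GRing.Theory Num.Theory.

(** Let [W] have cardinality aleph_1. [M] consists of the finitely supported
    functions from the positive rationals to [W], and the distance between two
    distinct functions is the largest rational at which they differ. Fix
    [q_1 > ... > q_k]. Calling a set of functions large when, for uncountably
    many values at [q_1], for uncountably many values at [q_2], and so on, it
    contains the resulting function, the sets that are not large form a
    sigma-ideal, so some color class is large. A large set contains a tree
    branching infinitely at each of the levels [q_1, ..., q_k], hence a copy of
    every finite ultrametric space with distances among the [q_i]. *)

(** * An uncountable well-order with countable initial segments *)

Lemma uncountable_set_nat : ~ countable [set: set nat].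
Proof.
move=> /countable_injP[f finj].
(* Cantor's diagonal set: the codes that do not lie in the set they code. *)
pose D := [set n | exists A, f A = n /\ ~ A n].
have Dinj A B : f A = f B -> A = B by apply: finj; rewrite inE.
have nD : ~ D (f D) by move=> DD; have [A [/Dinj -> /(_ DD)]] := DD.
by apply: (nD); exists D.
Qed.

(** In a well-order of [set nat], the points with countably many predecessors form a copy of
    omega_1. Its countable initial segments later make the space embed in every uncountable set. *)
Lemma exists_omega1 : exists (W : choiceType) (lt : W -> W -> Prop),
  [/\ well_founded lt, forall x y, [\/ lt x y, x = y | lt y x],
      forall x, countable [set y | lt y x] & ~ countable [set: W]].
Proof.
have [R Rwo] := well_ordering_principle (set nat).
have Rmin (P : set (set nat)) :
    P !=set0 -> exists2 x, P x & forall y, P y -> R x y.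
  move=> [x Px]; have [|z [[zP zmin] _]] := Rwo (mem P).
    by exists x; apply/mem_set.
  exists z; first exact: set_mem zP.
  by move=> y Py; apply: zmin; apply/mem_set.
have Rtot x y : R x y \/ R y x.
  have [|z /= [->|->] zmin] := Rmin [set x; y]; first by exists x; left.
    by left; apply: zmin; right.
  by right; apply: zmin; left.
have Ranti x y : R x y -> R y x -> x = y.
  move=> xy yx; apply: (@wo_chain_antisymmetric _ R predT) => //; last exact/andP.
  exact: withinW.
pose lt x y := ~~ R y x.
have ltwf (P : set (set nat)) :
    P !=set0 -> exists2 x, P x & forall y, lt y x -> ~ P y.
  move=> /Rmin[x Px xmin]; exists x => // y /negP yx Py; apply: yx; exact: xmin.
(* [V] is an initial segment; a countable [V] would contain the least element
   outside it. *)
pose V := [set x | countable [set y | lt y x]].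
have Vunc : ~ countable V.
  move=> Vc; have [[x Vx]|V0] := pselect ((~` V) !=set0).
    have [|z Vz zmin] := ltwf (~` V); first by exists x.
    apply: Vz; apply: sub_countable Vc; apply: subset_card_le => y /= yz.
    by apply: contrapT; exact: zmin.
  apply: uncountable_set_nat; apply: sub_countable Vc.
  apply: subset_card_le => y _; apply: contrapT => Vy.
  by apply: V0; exists y.
pose W : choiceType := {x : set nat | countable [set y | lt y x]}.
exists W, (fun x y => lt (val x) (val y)); split.
- move=> w; apply: contrapT => nacc.
  pose lW (x y : W) := lt (val x) (val y).
  have [|x [u uN <-] xmin] := ltwf (val @` [set u | ~ Acc lW u]).
    by exists (val w), w.
  apply: uN; constructor => v vu; apply: contrapT => vN.
  by apply: (xmin (val v) vu); exists v.
- move=> x y; rewrite /lt; have [xy|xy] := boolP (R (val x) (val y)); last first.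
    exact: Or33.
  have [yx|yx] := boolP (R (val y) (val x)); last exact: Or31.
  by apply: Or32; apply: val_inj; exact: Ranti.
- move=> x; have /countable_injP[f finj] := valP x.
  apply/countable_injP; exists (f \o val) => y z; rewrite !inE => yx zx fyz.
  by apply: val_inj; apply: finj fyz; rewrite inE.
- move=> /countable_injP[f finj]; apply: Vunc; apply/countable_injP.
  (* Injectivity is only required on [V], so the value [0] elsewhere is arbitrary. *)
  exists (fun x => if insub x is Some w then f w else 0%N) => x y.
  rewrite !inE => Vx Vy.
  have insubV := insubT (fun x : set nat => countable [set y | lt y x]).
  rewrite (insubV _ _ Vx) (insubV _ _ Vy).
  move=> /(finj _ _ _ _) e.
  by have [] : Sub x Vx = Sub y Vy :> W by apply: e; rewrite inE.
Qed.

(** * Injections into uncountable sets *)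

(** A point of [B] serves as the value off [A], so that membership of the values in [B] carries no
    side condition. *)
Lemma card_le_injective (T U : Type) (A : set T) (B : set U) :
  B !=set0 -> (A #<= B)%card ->
  exists2 f : T -> U, forall x, B (f x) & {in A &, injective f}.
Proof.
elim/Ppointed: U => U in B *; first by rewrite emptyE => -[].
move=> [b Bb] /pcard_leP/injfunPex[f fAB finj].
exists (fun x => if x \in A then f x else b).
  by move=> x; case: ifPn => // /set_mem; exact: fAB.
by move=> x y Ax Ay; rewrite Ax Ay; exact: finj.
Qed.

Lemma countable_setU (U : Type) (A B : set U) :
  countable A -> countable B -> countable (A `|` B).
Proof.
move=> Ac Bc; rewrite -bigcup2inE; apply: bigcup_countable => //.
by case=> [|[|]].
Qed.

Lemma infinite_setD_countable (U : Type) (B C : set U) :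
  ~ countable B -> countable C -> infinite_set (B `\` C).
Proof.
move=> Bunc Cc /finite_set_countable BCc; apply: Bunc.
apply: sub_countable (countable_setU BCc Cc); apply: subset_card_le => u Bu.
by have [Cu|Cu] := pselect (C u); [right | left].
Qed.

(* Well-founded recursion along [W]: the fiber over [x] is injected into [B] minus
   the countable set of values taken on the fibers below [x]. *)
Lemma card_le_countable_fibers (W : Type) (lt : W -> W -> Prop) (T U : Type)
    (r : T -> W) (B : set U) :
  well_founded lt -> (forall x y, [\/ lt x y, x = y | lt y x]) ->
  (forall x, countable [set y | lt y x]) ->
  (forall x, countable (r @^-1` [set x])) ->
  ~ countable B -> ([set: T] #<= B)%card.
Proof.
elim/Ppointed: U => U in B *.
  by rewrite emptyE => _ _ _ _ []; exact: countable0.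
move=> ltwf lttri ltc rc Bunc.
pose fits x (C : set U) (h : T -> U) :=
  (forall t, (B `\` C) (h t)) /\ {in r @^-1` [set x] &, injective h}.
(* The choice is made for all pairs at once, before the recursion. Countability of the avoided set
   is only known afterwards, so it stays a premise. *)
have /choice[phi phiP] (p : W * set U) :
    exists h, countable p.2 -> fits p.1 p.2 h.
  case: p => x C /=.
  have [Cc|Cunc] := pselect (countable C); last first.
    have [u _] := infinite_setN0 (infinite_setD_countable Bunc (countable0 U)).
    by exists (fun=> u) => /Cunc.
  have BC := infinite_setD_countable Bunc Cc.
  have [|h hBC hinj] :=
      @card_le_injective _ _ (r @^-1` [set x]) _ (infinite_setN0 BC).
    by apply: card_le_trans (rc x) _; exact/infiniteP.
  by exists h.
pose used x (G : forall z, lt z x -> T -> U) : set U :=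
  [set u | exists z (zx : lt z x), exists2 s, r s = z & G z zx s = u].
pose F := Fix ltwf (fun=> T -> U) (fun x G => phi (x, used x G)).
pose below x := \bigcup_(z in [set z | lt z x]) F z @` (r @^-1` [set z]).
have FE x : F x = phi (x, below x).
  rewrite [LHS]Fix_eq => [|y G G' GG']; last first.
    congr (phi (y, _)); congr used.
    by apply: functional_extensionality_dep => z; exact: functional_extensionality_dep.
  congr (phi (x, _)); apply/seteqP; split=> u.
    by move=> [z [zx [s rs <-]]]; exists z => //; exists s.
  by move=> [z zx [s rs <-]]; exists z, zx, s.
have Fx x : fits x (below x) (F x).
  rewrite FE; apply: (phiP (_, _)) => /=; apply: bigcup_countable => [|z _].
    exact: ltc.
  exact: sub_countable (card_image_le _ _) (rc z).
(* A value taken over [r s] belongs to [below (r t)], which [F (r t)] avoids. *)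
have Flt s t : lt (r s) (r t) -> F (r s) s = F (r t) t -> False.
  move=> st e; have [/(_ t)[_ +] _] := Fx (r t); apply.
  by rewrite -e; exists (r s) => //; exists s.
have Finj : injective (fun t => F (r t) t).
  move=> s t e; have [|rst|] := lttri (r s) (r t).
  - by move=> /Flt/(_ e).
  - have [_] := Fx (r t); apply; rewrite ?inE//.
    by rewrite -[in LHS]rst.
  - by move=> /Flt/(_ (esym e)).
apply/pcard_leP/injfunPex.
exists (fun t => F (r t) t); last by move=> s t _ _; exact: Finj.
by move=> t _; have [/(_ t)[]] := Fx (r t).
Qed.

(** * The ultrametric space of finitely supported functions *)

Section Space.
Variables (R : realType) (W : choiceType) (w0 : W).

Definition pos_rat := {q : rat | (0 < q)%R}.

Definition fs_space := {fsfun pos_rat -> W with w0}.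
Implicit Types (f g h : fs_space) (l : seq pos_rat) (A : set fs_space).

(** Both functions equal [w0] off the two supports, so this finite maximum sees every difference;
    the default [0] is the distance between equal functions. *)
Definition udist f g : rat :=
  \big[Order.max/0%R]_(q <- (finsupp f `|` finsupp g)%fset | f q != g q) val q.

Local Open Scope ring_scope.

Lemma udist_ge0 f g : 0 <= udist f g.
Proof.
rewrite /udist; elim/big_ind: _ => // [x y x0 _|q _].
  by rewrite le_max x0.
by rewrite ltW// (valP q).
Qed.

Lemma udist_leP f g (c : rat) : 0 <= c ->
  udist f g <= c <-> forall q : pos_rat, c < val q -> f q = g q.
Proof.
move=> c0; split=> [fgc q cq|fgE].
  apply/eqP/negPn/negP => fgq.
  have [qs|] := boolP (q \in (finsupp f `|` finsupp g)%fset).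
    have := le_bigmax_seq 0 q (fun p => f p != g p) (fun p => val p) qs fgq.
    by move=> /le_trans/(_ fgc); rewrite leNgt cq.
  rewrite !inE negb_or => /andP[/fsfun_dflt qf /fsfun_dflt qg].
  by rewrite qf qg eqxx in fgq.
apply: bigmax_le => // q; apply: contraR; rewrite -ltNge => cq.
by rewrite fgE.
Qed.

Lemma udist_val f g (q : pos_rat) :
  f q != g q -> (forall p : pos_rat, val q < val p -> f p = g p) ->
  udist f g = val q.
Proof.
move=> fgq fgE; apply/le_anti/andP; split.
  by apply/udist_leP => //; rewrite ltW// (valP q).
rewrite leNgt; apply/negP => /(proj1 (udist_leP _ _ (udist_ge0 f g)) (lexx _) _) /eqP.
exact/negP.
Qed.

Lemma udistxx f : udist f f = 0.
Proof. by apply/le_anti; rewrite udist_ge0 andbT; apply/udist_leP. Qed.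

Lemma udist_sym f g : udist f g = udist g f.
Proof.
wlog: f g / udist g f <= udist f g => [H|gf].
  by have [/H|/ltW/H] := leP (udist g f) (udist f g).
apply/le_anti; rewrite gf andbT; apply/udist_leP; first exact: udist_ge0.
by move=> q /(proj1 (udist_leP _ _ (udist_ge0 g f)) (lexx _) _).
Qed.

Lemma udist_ultra g f h : udist f h <= Num.max (udist f g) (udist g h).
Proof.
apply/udist_leP => [|q]; first by rewrite le_max udist_ge0.
rewrite gt_max => /andP[fg gh].
rewrite (proj1 (udist_leP _ _ (udist_ge0 f g)) (lexx _) _ fg).
exact: (proj1 (udist_leP _ _ (udist_ge0 g h)) (lexx _) _ gh).
Qed.

Definition fs_dist f g : R := ratr (udist f g).

Lemma fs_distxx f : fs_dist f f = 0.
Proof. by rewrite /fs_dist udistxx rmorph0. Qed.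

Lemma fs_dist_eq0 f g : fs_dist f g = 0 -> f = g.
Proof.
move=> /eqP; rewrite fmorph_eq0 => /eqP fg; apply/fsfunP => q.
by apply: (proj1 (udist_leP _ _ (lexx 0))); rewrite ?fg// (valP q).
Qed.

Lemma fs_dist_sym f g : fs_dist f g = fs_dist g f.
Proof. by rewrite /fs_dist udist_sym. Qed.

Lemma fs_dist_ultra f g h :
  fs_dist f h <= Num.max (fs_dist f g) (fs_dist g h).
Proof.
by rewrite le_max !ler_rat -le_max udist_ultra.
Qed.

Lemma fs_dist_triangle g f h :
  fs_dist f h <= fs_dist f g + fs_dist g h.
Proof.
apply: le_trans (fs_dist_ultra f g h) _.
by rewrite ge_max lerDl lerDr !ler0q !udist_ge0.
Qed.

HB.instance Definition _ := Choice.on fs_space.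
HB.instance Definition _ := isMetric.Build R fs_space fs_distxx
  fs_dist_eq0 fs_dist_sym fs_dist_triangle.

(** A function is coded by its finite graph over its support, with the values replaced by natural
    numbers. *)
Lemma countable_bounded_fsfun (V : set W) : countable V ->
  countable [set f : fs_space | forall q, V (f q)].
Proof.
move=> /countable_injP[e einj].
pose code f := [seq (q, e (f q)) | q <- finsupp f].
have code_inj : {in [set f : fs_space | forall q, V (f q)] &, injective code}.
  move=> f g; rewrite !inE => Vf Vg fg.
  have fgs : finsupp f = finsupp g.
    apply/fsetP => q; have := congr1 (fun s => q \in unzip1 s) fg.
    by rewrite /unzip1 -!map_comp !map_id.
  apply/fsfunP => q; have [qf|qf] := boolP (q \in finsupp f); last first.
    by rewrite !fsfun_dflt// -fgs.
  move: fg; rewrite /code fgs => /eq_in_map/(_ q); rewrite -fgs => /(_ qf)[].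
  by apply: einj; rewrite inE.
have /countable_injP[c cinj] : countable [set: seq (pos_rat * nat)].
  exact: countableP.
apply/countable_injP; exists (c \o code) => f g fV gV /(cinj _ _ _ _) fg.
by apply: code_inj => //; apply: fg; rewrite inE.
Qed.

(** * Large sets and the trees inside them *)

(* Largeness with respect to the iterated Fubini power of the ideal of countable
   sets, one factor for each level in [l]; off [l] the values are those of [g]. *)
Fixpoint large l g A : Prop :=
  if l is q :: l' then ~ countable [set w | large l' [fsfun g with q |-> w] A]
  else A g.

(** Level by level: if no [A n] were large, the values at [q] that keep the union large would lie in
    a countable union of countable sets. *)
Lemma large_bigcup l g (A : nat -> set fs_space) :
  large l g (\bigcup_n A n) -> exists n, large l g (A n).
Proof.
elim: l g => [g [n _ An]|q l IHl g /= gA]; first by exists n.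
apply: contrapT => /forallNP Asmall; apply: gA.
apply: (@sub_countable _ _ _
    (\bigcup_n [set w | large l [fsfun g with q |-> w] (A n)])).
  by apply: subset_card_le => w /IHl[n An]; exists n.
apply: bigcup_countable => [|n _]; first exact: countableP.
by apply: contrapT; exact: Asmall n.
Qed.

Lemma largeT l g : ~ countable [set: W] -> large l g setT.
Proof.
move=> Wunc; elim: l g => //= q l IHl g; apply: contra_not Wunc => lc.
by apply: sub_countable lc; apply: subset_card_le => w _; exact: IHl.
Qed.

(** Induction on the levels, from the largest down. The set [Y] lets the induction hypothesis act on
    a single class, and agreement with [g] off [l] preserves the value already chosen at [q]. *)
Lemma large_embedding (X : metricType R) l g A (Y : set X) :
  finite_set [set: X] -> ultrametric X ->
  pairwise (fun p q : pos_rat => val q < val p) l -> large l g A ->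
  (forall x y, Y x -> Y y ->
    x = y \/ exists2 q, q \in l & mdist x y = ratr (val q)) ->
  exists phi : X -> fs_space,
    (forall x, Y x -> A (phi x) /\ forall q, q \notin l -> phi x q = g q) /\
    (forall x y, Y x -> Y y -> ratr (udist (phi x) (phi y)) = mdist x y).
Proof.
move=> Xfin Xu; elim: l g Y => [|q l IHl] g Y.
  move=> _ Ag Yl; exists (fun=> g); split=> // x y Yx Yy.
  by have [->|[]//] := Yl x y Yx Yy; rewrite udistxx rmorph0 mdistxx.
rewrite pairwise_cons => /andP[/allP ql lsorted] /= gA Yl.
have qNl : q \notin l by apply/negP => /ql; rewrite ltxx.
set S := [set w | _] in gA.
(* The classes at distance below the largest level [q] get distinct values at [q];
   each of them is embedded by induction. *)
pose cls x : set X := [set y | mdist x y < ratr (val q)].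
(* By the ultrametric inequality, lying at distance below [q] is an equivalence relation. *)
have cls_eq x y : mdist x y < ratr (val q) -> cls x = cls y.
  have sub u v : mdist u v < ratr (val q) -> cls u `<=` cls v.
    move=> uv z uz; apply: le_lt_trans (Xu v u z) _.
    by rewrite gt_max metric_sym uv.
  by move=> xy; apply/seteqP; split; apply: sub => //; rewrite metric_sym.
have cls_mem x : cls x x by rewrite /cls/= mdistxx ltr0q (valP q).
have Sinf : infinite_set S by move=> /finite_set_countable.
have [|iota iotaS iota_inj] :=
    @card_le_injective _ _ (cls @` setT) S (infinite_setN0 Sinf).
  apply: (@card_le_trans _ _ _ [set: nat]); last exact/infiniteP.
  exact/finite_set_countable/finite_image.
have /choice[phi phiP] (C : set X) : exists phi : X -> fs_space,
    (forall x, (Y `&` [set x | cls x = C]) x ->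
      A (phi x) /\
        forall p, p \notin l -> phi x p = [fsfun g with q |-> iota C] p) /\
    (forall x y, (Y `&` [set x | cls x = C]) x ->
        (Y `&` [set x | cls x = C]) y ->
      ratr (udist (phi x) (phi y)) = mdist x y).
  apply: IHl => //; first exact: iotaS.
  (* Inside a class distances are below [q], so nonzero ones come from the remaining levels. *)
  move=> x y [Yx xC] [Yy yC]; have [|[p]] := Yl x y Yx Yy; first by left.
  rewrite inE => /predU1P[->|pl] xyp; last by right; exists p.
  have : cls x y by rewrite xC -yC.
  by rewrite /cls /= xyp ltxx.
have phi_q x p : Y x -> p \notin l ->
    phi (cls x) x p = if p == q then iota (cls x) else g p.
  by move=> Yx pl; have [/(_ x)[]// _ ->//] := phiP (cls x); rewrite fsfun_withE.
exists (fun x => phi (cls x) x); split=> [x Yx|x y Yx Yy].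
  split; first by have [/(_ x)[]] := phiP (cls x).
  by move=> p; rewrite inE negb_or => /andP[/negPf pq pl]; rewrite phi_q// pq.
have [xy|xy] := pselect (cls x = cls y).
  by rewrite xy; have [_] := phiP (cls y); apply.
(* Across classes the distance is at least [q], the largest level, hence equal to it. *)
have qxy : ratr (val q) <= mdist x y.
  by rewrite leNgt; apply/negP => /cls_eq.
have -> : mdist x y = ratr (val q).
  have [xyE|[p]] := Yl x y Yx Yy; first by rewrite xyE in xy.
  rewrite inE => /predU1P[->//|/ql pq] xyp.
  by move: qxy; rewrite xyp ler_rat leNgt pq.
(* The images differ at [q] by injectivity of [iota], and both agree with [g] above [q], where no
   level lies. *)
congr ratr; apply: udist_val => [|p qp].
  rewrite !phi_q// eqxx; apply/eqP => /iota_inj; rewrite !inE => xyC.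
  by apply: xy; apply: xyC; [exists x|exists y].
have pl : p \notin l by apply/negP => /ql; rewrite ltNge ltW.
have pq : p != q by apply: contraTneq qp => ->; rewrite ltxx.
by rewrite !phi_q// (negPf pq).
Qed.

End Space.

(** * Cardinality of the space and monochromatic copies *)

Theorem theorem3p2 (R : realType) :
  exists M : metricType R,
    [/\ rational_metric M, ultrametric M, has_card_aleph1 [set: M] &
      forall (chi : M -> nat) (X : metricType R),
        finite_set [set: X] -> rational_metric X -> ultrametric X ->
        exists A : set M, monochromatic chi A /\ isometric_to_subset X A].
Proof.
have [W [lt [ltwf lttri ltc Wunc]]] := exists_omega1.
have [w0 _] : [set: W] !=set0.
  by apply/set0P/eqP => W0; apply: Wunc; rewrite W0.
pose M : metricType R := fs_space w0.
exists M; split.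
- by move=> f g; exists (udist f g).
- exact: fs_dist_ultra.
- split.
    move=> /countable_injP[e einj]; apply: Wunc; apply/countable_injP.
    (* Functions supported in a single rational embed [W] into [M]. *)
    pose one : pos_rat := exist _ 1%R ltr01.
    exists (fun w => e [fsfun [fsfun with w0] with one |-> w]) => v w _ _ /einj.
    rewrite !inE => /(_ I I) /(congr1 (fun f : fs_space w0 => f one)).
    by rewrite !fsfun_with.
  have /choice[r rP] (f : M) : exists w, forall q, f q = w \/ lt (f q) w.
    (* Uncountably many [w] are not below any of finitely many values. *)
    have [w wP] : exists w, forall v,
        v \in w0 :: [seq f q | q <- finsupp f] -> v = w \/ lt v w.
      apply: contrapT => /forallNP unbounded; apply: Wunc.
      apply: (@sub_countable _ _ _
        (\bigcup_(v in [set` w0 :: [seq f q | q <- finsupp f]]) [set w | lt w v])).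
        apply: subset_card_le => w _; apply: contrapT => wN.
        apply: (unbounded w) => v vs.
        have [|->|wv] := lttri v w; [by right|by left|].
        by case: wN; exists v.
      by apply: bigcup_countable => [|v _]; [exact/finite_set_countable|exact: ltc].
    exists w => q; apply: wP; rewrite inE; case: finsuppP => qf.
      by rewrite eqxx.
    by rewrite (map_f f) ?orbT.
  move=> U B; apply: (@card_le_countable_fibers W lt M U r) => //.
  (* Over [w] all values lie in the countable initial segment up to [w]. *)
  move=> w; apply: (@sub_countable _ _ _
    [set f : M | forall q, (w |` [set v | lt v w]) (f q)]).
    by apply: subset_card_le => f <-; exact: rP.
  apply: countable_bounded_fsfun; exact: countable_setU.
- move=> chi X Xfin Xrat Xu.
  (* The levels are the positive distances occurring in [X]. *)
  pose D : set pos_rat := [set q | exists x y : X, mdist x y = ratr (val q)].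
  have /finite_seqP[s Ds] : finite_set D.
    apply: (@sub_finite_set _ _ ((fun q : pos_rat => ratr (val q) : R) @^-1`
        ((fun p : X * X => mdist p.1 p.2) @` [set: X * X]))).
      by move=> q [x [y xy]]; exists (x, y).
    apply: finite_preimage.
      by move=> p q _ _ /fmorph_inj/val_inj.
    by apply: finite_image; rewrite -setXTT; exact: finite_setX.
  pose l := sort (fun p q : pos_rat => val q <= val p)%R (undup s).
  have lsorted : pairwise (fun p q : pos_rat => val q < val p)%R l.
    have : pairwise (fun p q : pos_rat => val q <= val p)%R l &&
        pairwise (fun p q => p != q) l.
      rewrite -uniq_pairwise sort_uniq undup_uniq andbT -sorted_pairwise.
        by apply: sort_sorted => p q; exact: le_total.
      by move=> p q r qp rq; exact: le_trans rq qp.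
    rewrite -pairwise_relI; apply: sub_pairwise => p q /= /andP[qp pq].
    by rewrite lt_neqAle qp andbT (inj_eq val_inj) eq_sym.
  have := largeT l [fsfun with w0] Wunc.
  (* The color classes cover [M], so one of them is large. *)
  rewrite (_ : setT = \bigcup_n (chi @^-1` [set n])); last first.
    by apply/seteqP; split=> // f _; exists (chi f).
  move=> /large_bigcup[c lc].
  have [|phi [phiP phiE]] := large_embedding (Y := setT) Xfin Xu lsorted lc.
    move=> x y _ _; have [->|xy] := eqVneq x y; [by left|right].
    have [q _ qxy] := Xrat x y.
    have q0 : (0 < q)%R by rewrite -(ltr0q R) qxy mdist_gt0.
    exists (exist _ q q0) => //.
    rewrite mem_sort mem_undup.
    suff : D (exist _ q q0) by rewrite Ds.
    by exists x, y; rewrite qxy.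
  exists (phi @` setT); split.
    by exists c => _ [x _ <-]; have [] := phiP x I.
  exists phi; split; last by move=> x y; rewrite -phiE.
  split=> //.
  move=> x y _ _ xy; apply: mdist_positivity.
  by rewrite -phiE// xy udistxx rmorph0.
Qed.
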